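(* Let $(M,g)$ be a general relativistic perfect fluid spacetime with isotropic pressure $p$, energy-density $\sigma$, cosmological constant $\lambda$, gravitational constant $k$ and velocity vector field $\xi$ with $g$-dual $1$-form $\eta$, so that $g(\xi,\xi)=-1$ and $$S(X,Y)=-\left(\lambda-\frac{r}{2}-kp\right)g(X,Y)+k(\sigma+p)\eta(X)\eta(Y)$$ for all $X,Y\in\chi(M)$. Suppose that $\xi$ is torse-forming of the form $\nabla_X\xi=X+\eta(X)\xi$ for all $X\in\chi(M)$. Then: 1. If $(\xi,\cdot)_{R}\cdot S=0$, then $p=-\sigma$. 2. If $(\xi,\cdot)_{\mathcal{P}}\cdot S=0$, then $p=-\sigma$ or $p=\frac{4\lambda+k\sigma-12}{3k}$. 3. If $(\xi,\cdot)_{\mathcal{C}}\cdot S=0$, then $p=-\sigma$ or $p=\frac{2\lambda-k\sigma-6}{3k}$. 4. If $(\xi,\cdot)_{\mathcal{H}}\cdot S=0$, then $p=-\sigma$ or $p=\frac{\lambda-1}{k}$.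
   Context: A perfect fluid spacetime here is a connected $4$-dimensional smooth manifold $M$ with a Lorentzian metric $g$ (one negative sign in the signature), a smooth vector field $\xi$ with $g(\xi,\xi)=-1$, its dual $1$-form $\eta(X)=g(X,\xi)$, and smooth functions $p,\sigma$ on $M$ (not necessarily constant); $\lambda$ is a real constant and $k>0$ is a real constant (e.g. $k=8\pi G$). $\chi(M)$ is the set of smooth vector fields, $\nabla$ the Levi-Civita connection, $R(X,Y)Z=\nabla_X\nabla_YZ-\nabla_Y\nabla_XZ-\nabla_{[X,Y]}Z$ the Riemann curvature tensor, $S(Y,Z)=\mathrm{trace}(X\mapsto R(X,Y)Z)$ the Ricci tensor, $Q$ the Ricci operator, $g(QX,Y)=S(X,Y)$, and $r$ the scalar curvature. Equalities such as $p=-\sigma$ are equalities of functions on $M$. The concircular, conformal and conharmonic curvature tensors ($\dim M=4$) are $$\mathcal{P}(X,Y)Z=R(X,Y)Z+\frac{r}{12}[g(Z,X)Y-g(Y,Z)X],$$ $$\mathcal{C}(X,Y)Z=R(X,Y)Z+\frac12\left\{-\frac{r}{3}[g(Z,X)Y-g(Y,Z)X]+g(Z,X)QY-g(Y,Z)QX+S(Z,X)Y-S(Y,Z)X\right\},$$ $$\mathcal{H}(X,Y)Z=R(X,Y)Z+\frac12[g(Z,X)QY-g(Y,Z)QX+S(Z,X)Y-S(Y,Z)X].$$ For a $(1,3)$-tensor field $\mathcal{T}$, the condition $(\xi,\cdot)_{\mathcal{T}}\cdot S=0$ means $$S(\mathcal{T}(\xi,X)Y,Z)+S(Y,\mathcal{T}(\xi,X)Z)=0\quad\text{for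 all }X,Y,Z\in\chi(M).$$ *)

(* Defs.v *)
From HB Require Import structures.
From mathcomp Require Import all_boot all_order all_algebra.
From mathcomp Require Import all_classical all_reals all_analysis.

Set Implicit Arguments.
Unset Strict Implicit.
Unset Printing Implicit Defensive.

Import Order.TTheory GRing.Theory Num.Theory.
Import numFieldNormedType.Exports.

Local Open Scope classical_set_scope.
Local Open Scope ring_scope.

(* Functions on an open set U of R^n are represented by total functions whose
   values outside U are irrelevant. *)
Fixpoint Ck (R : realType) (n : nat) (k : nat) (U : set 'rV[R]_n)
    (f : 'rV[R]_n -> R) : Prop :=
  match k with
  | 0 => forall x, U x -> {for x, continuous f}
  | k'.+1 => (forall x, U x -> differentiable f x) /\
             (forall v, Ck k' U (fun x => 'D_v f x))
  end.

Definition smooth_on (R : realType) (n : nat) (U : set 'rV[R]_n)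
    (f : 'rV[R]_n -> R) : Prop := forall k, Ck k U f.

(* A homeomorphism [coord] from an open set of M onto an open set of R^n, with
   inverse [param]; both maps are total, with irrelevant values outside these
   open sets. *)
Record chart (R : realType) (n : nat) (M : topologicalType) := Chart {
  dom : set M;
  coord : M -> 'rV[R]_n;
  param : 'rV[R]_n -> M;
  dom_open : open dom;
  image_open : open (coord @` dom);
  coordK : forall x, dom x -> param (coord x) = x;
  coord_continuous : forall x, dom x -> {for x, continuous coord};
  param_continuous :
    forall y, (coord @` dom) y -> {for y, continuous param} }.

Record manifold (R : realType) (n : nat) := Manifold {
  points :> topologicalType;
  manifold_hausdorff : hausdorff_space points;
  manifold_second_countable : @second_countable points;
  atlas : set (chart R n points);
  atlas_cover : forall x, exists2 c, atlas c & dom c x;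
  atlas_smooth : forall c d, atlas c -> atlas d -> forall j : 'I_n,
    smooth_on (coord c @` (dom c `&` dom d))
              (fun y => coord d (param c y) ord0 j) }.

Section Manifold.
Context {R : realType} {n : nat} {M : manifold R n}.

Definition smooth (f : M -> R) : Prop :=
  forall c, atlas c -> smooth_on (coord c @` dom c) (f \o param c).

(* A tangent vector at x is a directional derivative at x, acting on smooth
   functions, along a vector u of R^n in a chart around x.  It is encoded as a
   functional on all functions M -> R that is 0 on the non-smooth ones: then
   two tangent vectors are equal iff they agree on the smooth functions. *)
Definition functional : Type := (M -> R) -> R.

Definition tangent (x : M) (v : functional) : Prop :=
  exists (c : chart R n M) (u : 'rV[R]_n),
    [/\ atlas c, dom c x &
        v = fun f => if `[< smooth f >]
                     then 'D_u (f \o param c) (coord c x) else 0].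

Definition basis_at (x : M) (e : 'I_n -> functional) : Prop :=
  (forall i, tangent x (e i)) /\
  (forall v, tangent x v ->
     exists! a : {ffun 'I_n -> R}, v = fun f => \sum_i a i * e i f).

(* The functions of this type inherit from R the pointwise operations +, -. *)
Definition tfield : Type := M -> functional.

Definition apply (X : tfield) (f : M -> R) : M -> R := fun x => X x f.

(* the smooth vector fields, chi(M) *)
Definition vfield (X : tfield) : Prop :=
  (forall x, tangent x (X x)) /\ (forall f, smooth f -> smooth (apply X f)).

Definition fscale (f : M -> R) (X : tfield) : tfield := fun x h => f x * X x h.

Definition bracket (X Y : tfield) : tfield :=
  fun x f => X x (apply Y f) - Y x (apply X f).

(* only the values g x u v with u and v tangent at x are meaningful *)
Definition metric : Type := M -> functional -> functional -> R.

Definition inner (g : metric) (X Y : tfield) : M -> R :=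
  fun x => g x (X x) (Y x).

Record lorentzian (g : metric) : Prop := Lorentzian {
  metric_sym : forall x u v, tangent x u -> tangent x v -> g x u v = g x v u;
  metric_linear : forall x (a : R) u v w,
    tangent x u -> tangent x v -> tangent x w ->
    g x (fun f => a * u f + v f) w = a * g x u w + g x v w;
  metric_signature : forall x, exists2 e : 'I_n -> functional, basis_at x e &
    forall i j, g x (e i) (e j) =
      if i == j then (if val i == 0%N then -1 else 1) else 0;
  metric_smooth : forall X Y, vfield X -> vfield Y -> smooth (inner g X Y) }.

(* The Levi-Civita connection is determined by these axioms on the smooth
   vector fields; the values of [nabla] elsewhere are irrelevant. *)
Record levi_civita (g : metric) (nabla : tfield -> tfield -> tfield) : Prop :=
  LeviCivita {
  nabla_vfield : forall X Y, vfield X -> vfield Y -> vfield (nabla X Y);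
  nabla_addl : forall X Y Z, vfield X -> vfield Y -> vfield Z ->
    nabla (X + Y) Z = nabla X Z + nabla Y Z;
  nabla_scalel : forall f X Z, smooth f -> vfield X -> vfield Z ->
    nabla (fscale f X) Z = fscale f (nabla X Z);
  nabla_addr : forall X Y Z, vfield X -> vfield Y -> vfield Z ->
    nabla X (Y + Z) = nabla X Y + nabla X Z;
  nabla_leibniz : forall f X Y, smooth f -> vfield X -> vfield Y ->
    nabla X (fscale f Y) = fscale f (nabla X Y) + fscale (apply X f) Y;
  nabla_torsion_free : forall X Y, vfield X -> vfield Y ->
    nabla X Y - nabla Y X = bracket X Y;
  nabla_metric : forall X Y Z, vfield X -> vfield Y -> vfield Z ->
    forall x, apply X (inner g Y Z) x =
              inner g (nabla X Y) Z x + inner g Y (nabla X Z) x }.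

Definition riemann (nabla : tfield -> tfield -> tfield) (X Y Z : tfield) :
    tfield :=
  nabla X (nabla Y Z) - nabla Y (nabla X Z) - nabla (bracket X Y) Z.

(* A map T on vector fields that is linear over the smooth functions induces an
   endomorphism of each tangent space, sending X x to T X x; [trace T x] is the
   trace of the latter, read off from vector fields E_i whose values at x form
   a basis.  The set below is then a singleton. *)
Definition trace (T : tfield -> tfield) : M -> R := fun x =>
  xget 0 [set t | exists (E : 'I_n -> tfield) (A : 'M[R]_n),
    [/\ forall i, vfield (E i),
        basis_at x (fun i => E i x),
        forall j, T (E j) x = fun f => \sum_i A i j * E i x f &
        t = \tr A]].

Definition ricci (nabla : tfield -> tfield -> tfield) (Y Z : tfield) : M -> R :=
  trace (fun X => riemann nabla X Y Z).

Definition ricci_operator (g : metric) (nabla : tfield -> tfield -> tfield)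
    (Q : tfield -> tfield) : Prop :=
  forall X, vfield X -> vfield (Q X) /\
    (forall Y, vfield Y -> inner g (Q X) Y = ricci nabla X Y).

Definition scalar_curvature (Q : tfield -> tfield) : M -> R := trace Q.

(* the condition (xi, .)_T . S = 0 *)
Definition annihilates_ricci (nabla : tfield -> tfield -> tfield)
    (xi : tfield) (T : tfield -> tfield -> tfield -> tfield) : Prop :=
  forall X Y Z, vfield X -> vfield Y -> vfield Z -> forall x,
    ricci nabla (T xi X Y) Z x + ricci nabla Y (T xi X Z) x = 0.

End Manifold.

Arguments functional {R n} M.
Arguments tfield {R n} M.
Arguments metric {R n} M.

(* The coefficients below are those of dimension 4. *)
Section CurvatureTensors.
Context {R : realType} {M : manifold R 4}.
Variables (g : metric M) (nabla : tfield M -> tfield M -> tfield M)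
          (Q : tfield M -> tfield M).

Local Notation r := (scalar_curvature Q).
Local Notation S := (ricci nabla).

Definition concircular (X Y Z : tfield M) : tfield M :=
  riemann nabla X Y Z
  + fscale (fun x => r x / 12)
      (fscale (inner g Z X) Y - fscale (inner g Y Z) X).

Definition conformal (X Y Z : tfield M) : tfield M :=
  riemann nabla X Y Z
  + fscale (fun=> 1 / 2)
      (fscale (fun x => - (r x / 3))
         (fscale (inner g Z X) Y - fscale (inner g Y Z) X)
       + fscale (inner g Z X) (Q Y) - fscale (inner g Y Z) (Q X)
       + fscale (S Z X) Y - fscale (S Y Z) X).

Definition conharmonic (X Y Z : tfield M) : tfield M :=
  riemann nabla X Y Z
  + fscale (fun=> 1 / 2)
      (fscale (inner g Z X) (Q Y) - fscale (inner g Y Z) (Q X)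
       + fscale (S Z X) Y - fscale (S Y Z) X).

End CurvatureTensors.

(* Main.v *)
(* The torse-forming condition gives R(X,Y)xi = eta(Y) X - eta(X) Y, whose trace
   is S(Y,xi) = 3 eta(Y).  Hence S = a g + b eta (x) eta with b = k (sigma + p)
   and a = 3 + b, so that r = 4 a - b = 12 + 3 b and b = 2 lambda - 6 - 2 k p;
   the last relation is the second alternative of (3), which therefore always
   holds.
   In the three other cases T(xi,X)Y = R(xi,X)Y + c (eta(Y) X - g(X,Y) xi) with
   c = 0, r / 12, (3 + a) / 2, and the skew-symmetry of R(X,Y) turns the
   condition on T into (1 - c) b = 0.  It reads b = 0, b^2 = 0 and
   b (b + 4) = 0 respectively; in the last case, b is constant because M is
   connected and b is continuous.
   Traces are defined through smooth vector fields, so each tangent vector has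
   to be extended to a smooth vector field, by means of the flat functions
   P(1/t) exp(-1/t). *)

Require Import Defs.
From HB Require Import structures.
From mathcomp Require Import all_boot all_order all_algebra.
From mathcomp Require Import all_classical all_reals all_analysis.
From mathcomp Require Import ring lra.

Set Implicit Arguments.
Unset Strict Implicit.
Unset Printing Implicit Defensive.

Import Order.TTheory GRing.Theory Num.Theory.
Import numFieldNormedType.Exports.
Import Defs.

Local Open Scope classical_set_scope.
Local Open Scope ring_scope.

(** * Calculus of C^k functions *)

(** The first-order expansion of f at x involves only values near x, so it is also an expansion of
    g; uniqueness of the differential then gives g the differential of f. *)
Lemma near_eq_differentiable (R : realType) (V W : normedModType R)
    (f g : V -> W) (x : V) :
  (\forall y \near x, f y = g y) -> differentiable f x -> differentiable g x.
Proof.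
move=> fg df.
have dg : g \o shift x = cst (g x) + 'd f x +o_ 0 id.
  apply/eqaddoP => e e0.
  have /eqaddoP/(_ _ e0) := diff_locally df.
  have fgx : f x = g x by exact: nbhs_singleton fg.
  have fg0 : \forall h \near 0, f (h + x) = g (h + x).
    by move: fg; rewrite (near_shift 0 x) subr0.
  apply: filterS2 fg0 => h fgh.
  change (`|f (h + x) - (f x + 'd f x h)| <= e * `|h| ->
          `|g (h + x) - (g x + 'd f x h)| <= e * `|h|).
  by rewrite fgh fgx.
have dgE := diff_unique (diff_continuous df) dg.
apply/diff_locallyP; split; first by rewrite dgE; exact: diff_continuous.
by rewrite dgE.
Qed.

Section Ck.
Context {R : realType} {n : nat}.
Implicit Types (U W : set 'rV[R]_n) (f g : 'rV[R]_n -> R).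

Lemma CkW k U f : Ck k.+1 U f -> Ck k U f.
Proof.
elim: k f => [|k IH] f [df Df] /=.
  by move=> x /df; exact: differentiable_continuous.
by split=> // v; exact/IH/Df.
Qed.

(** Each clause of [Ck] is a condition at single points, with derivatives taken in the whole space,
    so it can be checked on a set W that varies with the point. This glues the local expressions in
    [smooth_extend]. *)
Lemma Ck_local k U f :
  (forall x, U x -> exists2 W, W x & Ck k W f) -> Ck k U f.
Proof.
elim: k f => [|k IH] f Uf /=.
  by move=> x /Uf[W Wx fW]; exact: fW.
split=> [x /Uf[W Wx [dW _]]|v]; first exact: dW.
by apply: IH => x /Uf[W Wx [_ DW]]; exists W => //; exact: DW.
Qed.

(** Openness of U turns agreement on U into agreement of germs, hence of all iterated derivatives at
    the points of U. *)
Lemma eq_Ck k U f g : open U -> (forall x, U x -> f x = g x) ->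
  Ck k U f -> Ck k U g.
Proof.
move=> oU; elim: k f g => [|k IH] f g fg /=.
  move=> fU x Ux; have fgx : {near x, f =1 g}.
    by near=> y; apply: fg; near: y; exact: open_nbhs_nbhs.
  by apply: cvg_trans (near_eq_cvg fgx) _; rewrite -fg//; exact: fU.
have nfg x : U x -> \forall y \near x, f y = g y.
  by move=> Ux; near=> y; apply: fg; near: y; exact: open_nbhs_nbhs.
case=> df Df; split=> [x Ux|v].
  exact: near_eq_differentiable (nfg _ Ux) (df _ Ux).
by apply: IH (Df v) => x Ux; exact: near_eq_derive (nfg _ Ux).
Unshelve. all: by end_near. Qed.

Lemma Ck_cst k U (a : R) : Ck k U (fun=> a).
Proof.
elim: k a => [|k IH] a /=; first by move=> x _; exact: cst_continuous.
split=> [x _|v]; first exact: differentiable_cst.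
suff -> : (fun x => 'D_v (fun=> a) x) = (fun=> 0) by exact: IH.
by apply/funext => x; exact: derive_cst.
Qed.

Lemma Ck_add k U f g : open U -> Ck k U f -> Ck k U g ->
  Ck k U (fun x => f x + g x).
Proof.
move=> oU; elim: k f g => [|k IH] f g /=.
  by move=> cf cg x Ux; exact: continuousD (cf x Ux) (cg x Ux).
case=> df Df [dg Dg]; split=> [x Ux|v].
  exact: differentiableD (df x Ux) (dg x Ux).
apply: eq_Ck (IH _ _ (Df v) (Dg v)) => // x Ux.
by rewrite -(deriveD (diff_derivable (df x Ux)) (diff_derivable (dg x Ux))).
Qed.

Lemma Ck_mul k U f g : open U -> Ck k U f -> Ck k U g ->
  Ck k U (fun x => f x * g x).
Proof.
move=> oU; elim: k f g => [|k IH] f g /=.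
  by move=> cf cg x Ux; exact: continuousM (cf x Ux) (cg x Ux).
move=> [df Df] [dg Dg]; split=> [x Ux|v].
  exact: differentiableM (df x Ux) (dg x Ux).
have Cf : Ck k U f by apply: CkW.
have Cg : Ck k U g by apply: CkW.
apply: (eq_Ck _ _ (Ck_add oU (IH _ _ Cf (Dg v)) (IH _ _ Cg (Df v)))) => //.
move=> x Ux; have := deriveM (diff_derivable (df x Ux))
  (diff_derivable (dg x Ux)).
by move=> ->.
Qed.

Lemma Ck_sum k U m (F : 'I_m -> 'rV[R]_n -> R) : open U ->
  (forall j, Ck k U (F j)) -> Ck k U (fun x => \sum_j F j x).
Proof.
move=> oU CF.
have -> : (fun x => \sum_j F j x) = \sum_j F j by apply/funext => x;
  rewrite fct_sumE.
apply: (big_ind (Ck k U)) => //; first exact: Ck_cst.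
by move=> f g; exact: Ck_add.
Qed.

Lemma Ck_coord k U (j : 'I_n) : Ck k U (fun x => x ord0 j).
Proof.
case: k => [|k] /=; first by move=> x _; exact: matrix_normedtype.coord_continuous.
split=> [x _|v]; first exact: differentiable_coord.
suff -> : (fun x => 'D_v (fun y : 'rV[R]_n => y ord0 j) x) = fun=> v ord0 j.
  exact: Ck_cst.
apply/funext => x; have /matrixP/(_ ord0 j) := derive_mx (@derivable_id _ _ x v).
by rewrite derive_id mxE => <-.
Qed.

End Ck.

(** * Chain rule and composition with smooth maps *)

Section composition.
Context {R : realType} {n m : nat}.
Implicit Types (U : set 'rV[R]_n) (V : set 'rV[R]_m).

Lemma differentiable_rowP (t : 'rV[R]_n -> 'rV[R]_m) y :
  (forall j, differentiable (fun z => t z ord0 j) y) -> differentiable t y.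
Proof.
move=> dt; have -> : t = \sum_(j < m) (fun z => t z ord0 j *: delta_mx 0 j).
  by apply/funext => z; rewrite fct_sumE; exact: row_sum_delta.
by apply: differentiable_sum => j; exact: differentiableZl.
Qed.

Lemma derive_comp_row (t : 'rV[R]_n -> 'rV[R]_m) (F : 'rV[R]_m -> R) y v :
  (forall j, differentiable (fun z => t z ord0 j) y) ->
  differentiable F (t y) ->
  'D_v (F \o t) y = 'D_('D_v t y) F (t y).
Proof.
move=> /differentiable_rowP dt dF.
rewrite !deriveE//; last exact: differentiable_comp.
by rewrite diff_comp.
Qed.

Lemma derive_sum_coord (F : 'rV[R]_m -> R) z u : differentiable F z ->
  'D_u F z = \sum_j u ord0 j * 'D_(delta_mx 0 j) F z.
Proof.
move=> dF; rewrite deriveE// {1}[u]row_sum_delta linear_sum.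
by apply: eq_bigr => j _; rewrite linearZ deriveE.
Qed.

(** Induction on k: the derivative of [F \o t] is a sum of products of a derivative of a component
    of t with a partial derivative of F composed with t, and the induction hypothesis covers the
    latter. *)
Lemma Ck_comp k U V (t : 'rV[R]_n -> 'rV[R]_m) F : open U ->
  (forall j, smooth_on U (fun z => t z ord0 j)) ->
  (forall y, U y -> V (t y)) -> Ck k V F -> Ck k U (F \o t).
Proof.
move=> oU st UV.
have dt y : U y -> forall j, differentiable (fun z => t z ord0 j) y.
  by move=> Uy j; have [+ _] := st j 1; apply.
elim: k F => [|k IH] F /=.
  move=> cF y Uy; apply: continuous_comp; last exact/cF/UV.
  exact/differentiable_continuous/differentiable_rowP/dt.
case=> dF DF; split=> [y Uy|v].
  by apply: differentiable_comp; [exact/differentiable_rowP/dt|exact/dF/UV].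
apply: (@eq_Ck _ _ _ _ (fun y => \sum_j
    'D_v (fun z => t z ord0 j) y * ('D_(delta_mx 0 j) F \o t) y)) => //.
  move=> y Uy; rewrite derive_comp_row//; [|exact: dt|exact/dF/UV].
  rewrite derive_sum_coord; last exact/dF/UV.
  apply: eq_bigr => j _; rewrite derive_mx ?mxE//.
  exact/diff_derivable/differentiable_rowP/dt.
apply: Ck_sum => // j; apply: Ck_mul => //; last exact/IH/DF.
by have [_] := st j k.+1; apply.
Qed.

End composition.

(** * Flat functions *)

Section flat.
Context {R : realType}.
Implicit Type p : {poly R}.

(** Allowing every polynomial p makes the family closed under differentiation, so smoothness follows
    by one induction. The case p = 1 is the classical function exp(-1/t). *)
Definition flat p (t : R) : R :=
  if 0 < t then p.[t^-1] * expR (- t^-1) else 0.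

Lemma flat_le0 p t : t <= 0 -> flat p t = 0.
Proof. by rewrite /flat leNgt => /negbTE ->. Qed.

(** With s = 1/t, exp s >= s^(i+2) / (i+2)!, so s^i exp(-s) <= (i+2)! t^2 for each monomial. Order 2
    is what makes the difference quotient at 0 tend to 0. *)
Lemma flat_quadratic p : exists2 C, 0 <= C & forall t, `|flat p t| <= C * t ^+ 2.
Proof.
exists (\sum_(i < size p) `|p`_i| * (i.+2)`!%:R) => [|t].
  by apply: sumr_ge0 => i _; rewrite mulr_ge0.
rewrite /flat; case: ifPn => [t0|_]; last first.
  by rewrite normr0 mulr_ge0 ?sqr_ge0// sumr_ge0// => i _; rewrite mulr_ge0.
rewrite normrM (ger0_norm (expR_ge0 _)) horner_coef.
apply: (@le_trans _ _ ((\sum_(i < size p) `|p`_i * t^-1 ^+ i|) * expR (- t^-1))).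
  by rewrite ler_wpM2r ?expR_ge0// ler_norm_sum.
rewrite !mulr_suml; apply: ler_sum => i _.
rewrite normrM -!mulrA ler_wpM2l// normrX ger0_norm ?invr_ge0 ?(ltW t0)//.
have := @expR_ge1Dxn _ t^-1 i.+1 (ltW _); rewrite invr_gt0 => /(_ t0) h.
have {}h : t^-1 ^+ i.+2 <= i.+2`!%:R * expR t^-1.
  rewrite mulrC -ler_pdivrMr ?ltr0n ?fact_gt0//.
  by apply: le_trans h; rewrite lerDr.
have -> : t^-1 ^+ i = t^-1 ^+ i.+2 * t ^+ 2.
  by rewrite -addn2 exprD -mulrA -exprMn mulVf ?gt_eqF// expr1n mulr1.
rewrite expRN ler_pdivrMr ?expR_gt0// [leRHS]mulrAC.
by rewrite ler_wpM2r ?sqr_ge0.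
Qed.

(** For t > 0 and s = 1/t, ds/dt = - s^2, so p(s) exp(-s) has derivative s^2 (p - p')(s) exp(-s). At
    t = 0 the quadratic bound applies. *)
Lemma is_derive_flat p (t : R) :
  is_derive t (1 : R) (flat p) (flat ('X^2 * (p - p^`())) t).
Proof.
case: (ltgtP t 0) => t0.
- rewrite [X in is_derive _ _ _ X]flat_le0 ?ltW//.
  apply: (@near_eq_is_derive _ _ _ (cst 0)).
  by near=> s; rewrite flat_le0// ltW//; near: s; exact: lt_nbhsl.
- have tn0 : t != 0 by rewrite gt_eqF.
  suff : is_derive t (1 : R) (fun s => p.[s^-1] * expR (- s^-1))
      (flat ('X^2 * (p - p^`())) t).
    apply: near_eq_is_derive; near=> s; rewrite /flat.
    by have -> : 0 < s by near: s; exact: lt_nbhsr.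
  have dV : is_derive t 1 (fun s : R => s^-1) (- t ^- 2).
    have := @deriveV R R^o id t 1 tn0 (@derivable_id _ _ t 1).
    rewrite derive_id [_ *: _]mulr1 => <-.
    by apply: derivableP; exact: derivableV.
  have dp := is_derive1_comp (f := horner p) (g := fun s : R => s^-1) _ dV.
  have dN := is_deriveN dV.
  have de := is_derive1_comp (f := expR) (g := fun s : R => - s^-1)
    (is_derive_expR (- t^-1)) dN.
  have := is_deriveM (dp _ (is_derive_poly p t^-1)) de.
  move=> /is_derive_eq; apply.
  rewrite /flat t0 hornerM hornerXn hornerD hornerN /= exprVn opprK.
  rewrite /GRing.scale /=; ring.
- subst t; have [C C0 bC] := flat_quadratic p.
  have f00 : flat p 0 = 0 by rewrite flat_le0.
  rewrite flat_le0//.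
  have cv : (fun h : R => h^-1 *: ((flat p \o shift 0) (h *: 1) - flat p 0))
      @ 0^' --> (0 : R).
    apply/cvgrPdist_le => e e0; near=> h.
    have h0 : h != 0 by near: h; exact: nbhs_dnbhs_neq.
    rewrite sub0r normrN f00 subr0 /= addr0 [h *: 1]mulr1 normrM normfV.
    rewrite mulrC ler_pdivrMr ?normr_gt0//.
    apply: le_trans (bC h) _; rewrite -[h ^+ 2]ger0_norm ?sqr_ge0// normrX.
    rewrite expr2 mulrA ler_wpM2r//.
    (* C may be 0, so C + 1 serves as the denominator. *)
    have : `|h| <= e / (C + 1).
      near: h; apply: dnbhs0_le; rewrite divr_gt0// ltr_wpDl//.
    rewrite ler_pdivlMr ?ltr_wpDl// => he; apply: le_trans he.
    by rewrite mulrC ler_wpM2l// lerDl.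
  by apply: DeriveDef; [apply/cvg_ex; exists 0|exact: cvg_lim cv].
Unshelve. all: by end_near. Qed.

Lemma Ck_flat n k (U : set 'rV[R]_n) (q : 'rV[R]_n -> R) p :
  open U -> smooth_on U q -> Ck k U (flat p \o q).
Proof.
move=> oU sq.
have df p' t : differentiable (flat p') t.
  by apply/derivable1_diffP; exact: (@ex_derive _ _ _ _ _ _ _ (is_derive_flat p' t)).
have dq y : U y -> differentiable q y by have [+ _] := sq 1; apply.
elim: k p => [|k IH] p /=.
  move=> y Uy; apply: continuous_comp; first exact/differentiable_continuous/dq.
  exact: differentiable_continuous.
split=> [y Uy|v]; first exact: differentiable_comp (dq _ Uy) _.
have [_ Dq] := sq k.+1.
apply: (eq_Ck oU _ (Ck_mul oU (IH ('X^2 * (p - p^`()))) (Dq v))) => y Uy.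
have -> : 'D_v (flat p \o q) y = 'd (flat p) (q y) ('D_v q y *: 1).
  rewrite deriveE; last exact: differentiable_comp (dq _ Uy) _.
  by rewrite diff_comp//= ?deriveE ?[_ *: 1]mulr1//; exact: dq.
rewrite linearZ -deriveE// (@derive_val _ _ _ _ _ _ _ (is_derive_flat p (q y))).
by rewrite mulrC.
Qed.

End flat.

(** * Smooth functions on a manifold *)

Section smooth_functions.
Context {R : realType} {n : nat} {M : manifold R n}.
Implicit Types (c d : chart R n M) (f h : M -> R) (x : M).

Lemma smooth_cst (a : R) : smooth (fun _ : M => a).
Proof. by move=> c _ k; exact: Ck_cst. Qed.

Lemma smooth_add f h : smooth f -> smooth h -> smooth (fun x => f x + h x).
Proof.
move=> sf sh c ac k.
by have := Ck_add (@image_open _ _ _ c) (sf c ac k) (sh c ac k).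
Qed.

Lemma smooth_mul f h : smooth f -> smooth h -> smooth (fun x => f x * h x).
Proof.
move=> sf sh c ac k.
by have := Ck_mul (@image_open _ _ _ c) (sf c ac k) (sh c ac k).
Qed.

Lemma smooth_differentiable f c x : smooth f -> atlas c -> dom c x ->
  differentiable (f \o param c) (coord c x).
Proof. by move=> sf ac cx; have [+ _] := sf c ac 1; apply; exists x. Qed.

Lemma smooth_continuous f : smooth f -> continuous f.
Proof.
move=> sf x; have [c ac cx] := atlas_cover x.
have fE : {near x, (f \o param c) \o coord c =1 f}.
  near=> z; rewrite /= coordK//; near: z.
  by apply: open_nbhs_nbhs; split; [exact: dom_open|].
apply: cvg_trans (near_eq_cvg fE) _.
rewrite -[X in f X](coordK cx).
apply: (@continuous_comp _ _ _ (coord c) (f \o param c)).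
  exact: coord_continuous.
exact/differentiable_continuous/smooth_differentiable.
Unshelve. all: by end_near. Qed.

Lemma open_coord_image c (D : set M) : open D -> open (coord c @` (dom c `&` D)).
Proof.
move=> oD; rewrite openE => _ [x [cx Dx] <-]; rewrite /interior.
have oc : nbhs (coord c x) (coord c @` dom c).
  by apply: open_nbhs_nbhs; split; [exact: image_open|exists x].
have cp : nbhs (coord c x) (param c @^-1` D).
  apply: param_continuous; first by exists x.
  by rewrite coordK//; exact: open_nbhs_nbhs.
near=> z; have [x' cx' zE] : (coord c @` dom c) z by near: z.
have : D (param c z) by near: z.
by rewrite -zE coordK// => Dx'; exists x'.
Unshelve. all: by end_near. Qed.

Lemma transition_smooth c d j : atlas c -> atlas d ->
  smooth_on (coord c @` (dom c `&` dom d))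
    (fun y => (coord d \o param c) y ord0 j).
Proof. by move=> ac ad k; exact: atlas_smooth. Qed.

Lemma transition_image c d y : (coord c @` (dom c `&` dom d)) y ->
  (coord d @` dom d) ((coord d \o param c) y).
Proof. by move=> [x [cx dx] <-]; exists x => //=; rewrite coordK. Qed.

(** Inside [dom c] the extension is G composed with a transition map. Around a point outside [dom c]
    it vanishes on the complement of K, which is open because K is closed. *)
Lemma smooth_extend c (K : set M) (G : 'rV[R]_n -> R) :
  atlas c -> closed K -> K `<=` dom c ->
  smooth_on (coord c @` dom c) G ->
  (forall x, dom c x -> ~ K x -> G (coord c x) = 0) ->
  smooth (fun x => if `[< dom c x >] then G (coord c x) else 0).
Proof.
move=> ac clK Kc sG G0 d ad k; apply: Ck_local => _ [x dx <-].
have [cx|ncx] := pselect (dom c x).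
  exists (coord d @` (dom d `&` dom c)); first by exists x.
  have oW : open (coord d @` (dom d `&` dom c)).
    by apply: open_coord_image; exact: dom_open.
  apply: (@eq_Ck _ _ _ _ (G \o (coord c \o param d))) => //.
    by move=> _ [z [dz cz] <-] /=; rewrite coordK//; case: asboolP.
  apply: (@Ck_comp _ _ _ _ _ (coord c @` dom c)) => //.
  - by move=> j; exact: transition_smooth.
  - by move=> y; exact: transition_image.
exists (coord d @` (dom d `&` ~` K)); first by exists x => //; split=> // /Kc.
apply: (eq_Ck _ _ (Ck_cst k _ 0)).
  by apply: open_coord_image; exact: closed_openC.
move=> _ [z [dz Kz] <-] /=; rewrite coordK//; case: asboolP => // cz.
by rewrite G0.
Qed.

(** A bump function: the flat function exp(-1/t) applied to e2^2 minus the squared Euclidean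
    distance to y0, normalized at y0. *)
Lemma cutoff c x : atlas c -> dom c x ->
  exists2 w : 'rV[R]_n -> R, w (coord c x) = 1 &
    smooth_on (coord c @` dom c) w /\
    exists K : set M, [/\ closed K, K `<=` dom c &
      forall z, dom c z -> ~ K z -> w (coord c z) = 0].
Proof.
move=> ac cx; set O := coord c @` dom c; set y0 := coord c x.
have : nbhs y0 O.
  by apply: open_nbhs_nbhs; split; [exact: image_open|exists x].
move=> /nbhs_ballP[e /= e0 eO].
pose e2 := e / 2; have e20 : 0 < e2 by rewrite divr_gt0.
pose q (y : 'rV[R]_n) := e2 ^+ 2 +
  \sum_j (-1) * ((y ord0 j + - y0 ord0 j) * (y ord0 j + - y0 ord0 j)).
have sq : smooth_on O q.
  have oO : open O by exact: image_open.
  have Cj k j : Ck k O (fun y : 'rV[R]_n => y ord0 j + - y0 ord0 j).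
    by apply: Ck_add => //; [exact: Ck_coord|exact: Ck_cst].
  move=> k; apply: Ck_add => //; first exact: Ck_cst.
  apply: Ck_sum => // j; apply: Ck_mul => //; first exact: Ck_cst.
  exact: Ck_mul.
pose w0 := (flat 1 (q y0))^-1.
have qy0 : q y0 = e2 ^+ 2.
  by rewrite /q big1 ?addr0// => j _; rewrite subrr mulr0 mulr0.
have fy0 : flat 1 (q y0) != 0.
  by rewrite qy0 /flat exprn_gt0// hornerC mul1r gt_eqF// expR_gt0.
exists (fun y => w0 * flat 1 (q y)); first by rewrite /w0 mulVf.
split.
  move=> k; apply: Ck_mul; [exact: image_open|exact: Ck_cst|].
  by apply: Ck_flat => //; exact: image_open.
(* Balls of row vectors are taken in the sup norm, so the ball of radius e contains this closed cube
   of half-side e2 = e / 2. Its image under [param c] is compact, hence closed since M is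
   Hausdorff. *)
pose B : set 'rV[R]_n :=
  [set y | forall j, `[y0 ord0 j - e2, y0 ord0 j + e2]%classic (y ord0 j)].
have BO : B `<=` O.
  move=> y By; apply: eO; split=> //= i j.
  rewrite (ord1 i) /ball /=; have := By j; rewrite /= in_itv /= => /andP[y1 y2].
  by rewrite ltr_norml; apply/andP; split; rewrite /e2 in e20 y1 y2; lra.
exists (param c @` B); split.
- apply: compact_closed; first exact: manifold_hausdorff.
  apply: continuous_compact.
    apply/continuous_in_subspaceT => y; rewrite inE => /BO.
    exact: param_continuous.
  apply: (@rV_compact R n (fun j => `[y0 ord0 j - e2, y0 ord0 j + e2]%classic)).
  by move=> j; exact: segment_compact.
- by move=> _ [y /BO[z cz <-] <-]; rewrite coordK.
- move=> z cz Kz; rewrite flat_le0 ?mulr0//.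
  have [j Hj] : exists j, ~ `[y0 ord0 j - e2, y0 ord0 j + e2]%classic
      (coord c z ord0 j).
    by apply: contrapT => /forallNP nB; apply: Kz; exists (coord c z);
      [move=> j; apply: contrapT; exact: nB|rewrite coordK].
  rewrite /q (bigD1 j)//=.
  (* Outside the cube some coordinate difference t has |t| >= e2, so q <= e2^2 - t^2 <= 0 and the
     flat function vanishes. *)
  set t := coord c z ord0 j + - y0 ord0 j.
  have : e2 ^+ 2 <= t ^+ 2.
    have [te|te] := leP e2 t; first by nra.
    suff : t <= - e2 by nra.
    rewrite leNgt; apply/negP => et; apply: Hj; rewrite /= in_itv /=.
    by move: te et; rewrite /t => te et; apply/andP; split; lra.
  have : \sum_(i < n | i != j) -1 * ((coord c z ord0 i + - y0 ord0 i) *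
      (coord c z ord0 i + - y0 ord0 i)) <= 0.
    by apply: sumr_le0 => i _; rewrite mulN1r oppr_le0 -expr2 sqr_ge0.
  rewrite -expr2; lra.
Qed.

End smooth_functions.

(** * Tangent vectors and vector fields *)

Section tangent_vectors.
Context {R : realType} {n : nat} {M : manifold R n}.
Implicit Types (c d : chart R n M) (f h : M -> R) (x : M) (u v : functional M).

Definition chart_vector c (a : 'rV[R]_n) x : functional M :=
  fun f => if `[< smooth f >] then 'D_a (f \o param c) (coord c x) else 0.

Lemma tangent_chart_vector c a x : atlas c -> dom c x ->
  tangent x (chart_vector c a x).
Proof. by move=> ac cx; exists c, a. Qed.

(** A tangent vector is given in some chart; the chain rule moves it to any chart d around x, its
    components being multiplied by the derivative of the transition map. *)
Lemma tangentP d x v : atlas d -> dom d x -> tangent x v ->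
  exists a, v = chart_vector d a x.
Proof.
move=> ad dx [c [b [ac cx ->]]].
exists ('D_b (coord d \o param c) (coord c x)).
apply/funext => f; rewrite /chart_vector; case: asboolP => // sf.
have tx : (coord d \o param c) (coord c x) = coord d x by rewrite /= coordK.
have oW : open (coord c @` (dom c `&` dom d)).
  by apply: open_coord_image; exact: dom_open.
have Wx : (coord c @` (dom c `&` dom d)) (coord c x) by exists x.
rewrite -tx -derive_comp_row.
- apply: near_eq_derive; near=> z.
  have [y [cy dy] <-] : (coord c @` (dom c `&` dom d)) z.
    by near: z; exact: open_nbhs_nbhs.
  by rewrite /= coordK// coordK.
- move=> j; have [+ _] := transition_smooth j ac ad 1.
  by apply.
- by rewrite tx; exact: smooth_differentiable.
Unshelve. all: by end_near. Qed.

Lemma chart_vectorP c x (a : R) b b' : atlas c -> dom c x ->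
  (fun f => a * chart_vector c b x f + chart_vector c b' x f) =
  chart_vector c (a *: b + b') x.
Proof.
move=> ac cx; apply/funext => f; rewrite /chart_vector.
case: asboolP => [sf|_]; last by rewrite mulr0 addr0.
have df := smooth_differentiable sf ac cx.
by rewrite !deriveE// linearP.
Qed.

Lemma tangent_lin x (a : R) u v : tangent x u -> tangent x v ->
  tangent x (fun f => a * u f + v f).
Proof.
have [c ac cx] := atlas_cover x.
move=> /(tangentP ac cx)[b ->] /(tangentP ac cx)[b' ->].
by rewrite chart_vectorP//; exact: tangent_chart_vector.
Qed.

Lemma tangent0 x : tangent x (fun=> 0).
Proof.
have [c ac cx] := atlas_cover x.
have -> : (fun=> 0) = chart_vector c 0 x.
  by apply/funext => f; rewrite /chart_vector derive0 if_same.
exact: tangent_chart_vector.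
Qed.

Lemma tangentD x u v : tangent x u -> tangent x v ->
  tangent x (fun f => u f + v f).
Proof.
move=> tu tv; have := tangent_lin 1 tu tv.
by under eq_fun do rewrite mul1r.
Qed.

Lemma tangentZ x (a : R) u : tangent x u -> tangent x (fun f => a * u f).
Proof.
move=> tu; have := tangent_lin a tu (tangent0 x).
by under eq_fun do rewrite addr0.
Qed.

Lemma tangent_addf x v f h : tangent x v -> smooth f -> smooth h ->
  v (fun z => f z + h z) = v f + v h.
Proof.
move=> [c [a [ac cx ->]]] sf sh.
rewrite !asboolT//; last exact: smooth_add.
rewrite -deriveD//; exact/diff_derivable/smooth_differentiable.
Qed.

Lemma vfieldD X Y : vfield X -> vfield Y -> vfield (X + Y : tfield M).
Proof.
move=> [tX sX] [tY sY]; split=> [x|f sf]; first exact: tangentD.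
exact: (smooth_add (sX f sf) (sY f sf)).
Qed.

Lemma vfieldZ f (X : tfield M) : smooth f -> vfield X -> vfield (fscale f X).
Proof.
move=> sf [tX sX]; split=> [x|h sh]; first exact: tangentZ.
exact: (smooth_mul sf (sX h sh)).
Qed.

Lemma vfieldN (X : tfield M) : vfield X -> vfield (- X).
Proof.
move=> vX; have -> : - X = fscale (fun=> -1) X.
  by apply/funext => x; apply/funext => f; rewrite /fscale mulN1r.
by apply: vfieldZ => //; exact: smooth_cst.
Qed.

Lemma vfieldB X Y : vfield X -> vfield Y -> vfield (X - Y : tfield M).
Proof. by move=> vX vY; apply: vfieldD => //; exact: vfieldN. Qed.

(** The field with constant components a in the chart c is multiplied by a cutoff equal to 1 at x,
    then extended by 0. *)
Lemma vfield_extend x v : tangent x v -> exists2 V, vfield V & V x = v.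
Proof.
move=> [c [a [ac cx vE]]]; have [w w1 [sw [K [clK Kc w0]]]] := cutoff ac cx.
pose V : tfield M := fun z f =>
  if `[< smooth f >] then
    if `[< dom c z >] then
      w (coord c z) * 'D_a (f \o param c) (coord c z) else 0
  else 0.
exists V; last first.
  apply/funext => f; rewrite /V vE; case: asboolP => // sf.
  by rewrite asboolT// w1 mul1r.
split=> [z|f sf].
  have [cz|ncz] := pselect (dom c z).
    have -> : V z = fun f => w (coord c z) * chart_vector c a z f.
      apply/funext => f; rewrite /V /chart_vector (asboolT cz).
      by case: asboolP; rewrite ?mulr0.
    exact/tangentZ/tangent_chart_vector.
  have -> : V z = fun=> 0.
    by apply/funext => f; rewrite /V (asboolF ncz) if_same.
  exact: tangent0.
have -> : apply V f = fun z => if `[< dom c z >] then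
    (fun y => w y * 'D_a (f \o param c) y) (coord c z) else 0.
  by apply/funext => z; rewrite /apply /V asboolT.
apply: (@smooth_extend _ _ _ c K (fun y => w y * 'D_a (f \o param c) y)) => //.
  move=> k; apply: Ck_mul => //; first exact: image_open.
  by have [_] := sf c ac k.+1; apply.
by move=> z cz Kz; rewrite w0// mul0r.
Qed.

End tangent_vectors.

(** * Lorentzian linear algebra and traces *)

Section lorentzian_algebra.
Context {R : realType} {n : nat} {M : manifold R n}.
Context (g : metric M) (gL : lorentzian g).
Implicit Types (x : M) (u v w : functional M).

Lemma metricDl x u v w : tangent x u -> tangent x v -> tangent x w ->
  g x (fun f => u f + v f) w = g x u w + g x v w.
Proof.
move=> tu tv tw; have := metric_linear gL 1 tu tv tw.
by under eq_fun do rewrite mul1r; rewrite mul1r.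
Qed.

Lemma metric0l x w : tangent x w -> g x (fun=> 0) w = 0.
Proof.
move=> tw; have t0 := @tangent0 _ _ _ x.
have := metricDl t0 t0 tw; under eq_fun do rewrite addr0.
by move=> /eqP; rewrite -subr_eq0 opprD addNKr oppr_eq0 => /eqP.
Qed.

Lemma metricZl x (a : R) u w : tangent x u -> tangent x w ->
  g x (fun f => a * u f) w = a * g x u w.
Proof.
move=> tu tw; have := metric_linear gL a tu (@tangent0 _ _ _ x) tw.
by under eq_fun do rewrite addr0; rewrite metric0l// addr0.
Qed.

Lemma metricDr x u v w : tangent x u -> tangent x v -> tangent x w ->
  g x w (fun f => u f + v f) = g x w u + g x w v.
Proof.
move=> tu tv tw; rewrite (metric_sym gL tw); last exact: tangentD.
by rewrite metricDl// !(metric_sym gL tw).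
Qed.

Lemma metricZr x (a : R) u w : tangent x u -> tangent x w ->
  g x w (fun f => a * u f) = a * g x w u.
Proof.
move=> tu tw; rewrite (metric_sym gL tw); last exact: tangentZ.
by rewrite metricZl// (metric_sym gL tw).
Qed.

Lemma tangent_sum x m (a : 'I_m -> R) (e : 'I_m -> functional M) :
  (forall i, tangent x (e i)) -> tangent x (fun f => \sum_i a i * e i f).
Proof.
move=> te; elim: m a e te => [|m IH] a e te.
  by under eq_fun do rewrite big_ord0; exact: tangent0.
under eq_fun do rewrite big_ord_recl.
by apply: tangent_lin => //; exact: IH.
Qed.

Lemma linear_tangent_sum x (b : functional M -> R) m (a : 'I_m -> R)
    (e : 'I_m -> functional M) :
  (forall (t : R) u v, tangent x u -> tangent x v ->
    b (fun f => t * u f + v f) = t * b u + b v) ->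
  (forall i, tangent x (e i)) ->
  b (fun f => \sum_i a i * e i f) = \sum_i a i * b (e i).
Proof.
move=> bl; elim: m a e => [|m IH] a e te.
  rewrite big_ord0; under eq_fun do rewrite big_ord0.
  have t0 := @tangent0 _ _ _ x; have := bl 1 _ _ t0 t0.
  under eq_fun do rewrite mulr0 addr0; rewrite mul1r => /eqP.
  by rewrite -subr_eq0 opprD addNKr oppr_eq0 => /eqP.
under eq_fun do rewrite big_ord_recl.
rewrite bl//; last exact: tangent_sum.
by rewrite IH// big_ord_recl.
Qed.

(** Pairing u - v with the vectors of an orthonormal basis returns its coefficients up to sign, so
    all of them are 0. *)
Lemma metric_nondegenerate x u v : tangent x u -> tangent x v ->
  (forall w, tangent x w -> g x u w = g x v w) -> u = v.
Proof.
move=> tu tv uv; pose z : functional M := fun f => u f + -1 * v f.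
have tNv : tangent x (fun f => -1 * v f) by exact: tangentZ.
have tz : tangent x z by exact: tangentD.
have z0 w : tangent x w -> g x z w = 0.
  by move=> tw; rewrite metricDl// metricZl// uv// mulN1r subrr.
have [e [te eb] ge] := metric_signature gL x.
have [a [za _]] := eb z tz.
suff a0 i : a i = 0.
  apply/funext => f; apply/eqP; rewrite -subr_eq0 -mulN1r -[X in X == _]/(z f).
  by rewrite za big1// => i _; rewrite a0 mul0r.
have := z0 _ (te i); rewrite {1}za.
rewrite (@linear_tangent_sum x (fun v => g x v (e i)))//; last first.
  by move=> t u' v' tu' tv'; rewrite metric_linear.
rewrite (bigD1 i)//= ge eqxx big1 ?addr0 => [|j /negbTE ji]; last first.
  by rewrite ge ji mulr0.
by case: ifP => _ /eqP; rewrite ?mulr1 ?mulrN1 ?oppr_eq0 => /eqP.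
Qed.

(** Each vector of an orthonormal basis at x is extended separately, so the frame is orthonormal at
    x but possibly not elsewhere. *)
Lemma orthonormal_frame x : exists E : 'I_n -> tfield M,
  [/\ forall i, vfield (E i), basis_at x (fun i => E i x) &
      forall i j, g x (E i x) (E j x) =
        if i == j then (if val i == 0%N then -1 else 1) else 0].
Proof.
have [e [te eb] ge] := metric_signature gL x.
have /choice[E HE] i : exists E, vfield E /\ E x = e i.
  by have [E] := vfield_extend (te i); exists E.
have Ee : (fun i => E i x) = e by apply/funext => i; have [] := HE i.
exists E; split=> [i| |i j]; first by have [] := HE i.
  by rewrite Ee.
by have [[_ ->] [_ ->]] := (HE i, HE j).
Qed.

(* In a basis of the tangent space, T is a%:M plus the rank one matrix with
   entries b(E_j) w_i. *)
Lemma trace_rank_one (T : tfield M -> tfield M) x (a : R)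
    (b : functional M -> R) w : tangent x w ->
  (forall (t : R) u v, tangent x u -> tangent x v ->
    b (fun f => t * u f + v f) = t * b u + b v) ->
  (forall X, vfield X -> T X x = fun f => a * X x f + b (X x) * w f) ->
  trace T x = n%:R * a + b w.
Proof.
move=> tw bl TE.
have key (E : 'I_n -> tfield M) (c : 'I_n -> R) : (forall i, vfield (E i)) ->
    w = (fun f => \sum_i c i * E i x f) ->
  let A := \matrix_(i, j) (a *+ (i == j) + b (E j x) * c i) in
  (forall j, T (E j) x = fun f => \sum_i A i j * E i x f) /\
  \tr A = n%:R * a + b w.
  move=> vE wE A; split=> [j|].
    rewrite TE//; apply/funext => f; rewrite wE mulr_sumr.
    under [RHS]eq_bigr do rewrite mxE mulrDl -mulrA.
    rewrite big_split /=; congr (_ + _).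
    rewrite (bigD1 j)//= eqxx mulr1n big1 ?addr0// => i /negbTE ->.
    by rewrite mul0r.
  rewrite /mxtrace; under eq_bigr do rewrite mxE eqxx.
  rewrite big_split /= sumr_const card_ord mulr_natl; congr (_ + _).
  rewrite wE (linear_tangent_sum c bl); last by move=> i; have [] := vE i.
  by apply: eq_bigr => i _; rewrite mulrC.
(* [trace] picks an element of a set, with default 0: one admissible frame must be exhibited, then
   every admissible frame and matrix shown to give the same value. *)
apply: xget_unique.
  have [E [vE bE _]] := orthonormal_frame x.
  have [c [wE _]] := bE.2 w tw.
  have [TA trA] := key E c vE wE.
  by exists E; eexists; split; [| |exact: TA|rewrite trA].
move=> t [E [A [vE bE TA ->]]].
have [c [wE _]] := bE.2 w tw; have [TA' <-] := key E c vE wE.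
congr (\tr _); apply/matrixP => i j.
have tT : tangent x (T (E j) x) by rewrite TA; apply: tangent_sum => k; exact: bE.1.
(* Coefficients in a basis are unique, so the j-th columns of both matrices coincide with d. *)
have [d [_ du]] := bE.2 _ tT.
set A' := \matrix_(i, j) _ in TA' *.
have d1 : d = [ffun k => A k j].
  by apply: du; rewrite TA; apply/funext => f; apply: eq_bigr => k _; rewrite ffunE.
have d2 : d = [ffun k => A' k j].
  by apply: du; rewrite TA'; apply/funext => f; apply: eq_bigr => k _; rewrite ffunE.
by move: d2; rewrite d1 => /ffunP/(_ i); rewrite !ffunE.
Qed.

End lorentzian_algebra.

(** * The curvature of a Levi-Civita connection *)

Section connection.
Context {R : realType} {n : nat} {M : manifold R n}.
Context (g : metric M) (gL : lorentzian g).
Context (nabla : tfield M -> tfield M -> tfield M).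
Context (nablaLC : levi_civita g nabla).
Implicit Types (X Y Z W : tfield M) (x : M).

Lemma innerDl X Y Z x : vfield X -> vfield Y -> vfield Z ->
  inner g (X + Y) Z x = inner g X Z x + inner g Y Z x.
Proof. by move=> [tX _] [tY _] [tZ _]; exact: metricDl. Qed.

Lemma innerDr X Y Z x : vfield X -> vfield Y -> vfield Z ->
  inner g Z (X + Y) x = inner g Z X x + inner g Z Y x.
Proof. by move=> [tX _] [tY _] [tZ _]; exact: metricDr. Qed.

Lemma innerZl f X Z x : vfield X -> vfield Z ->
  inner g (fscale f X) Z x = f x * inner g X Z x.
Proof. by move=> [tX _] [tZ _]; exact: metricZl. Qed.

Lemma innerZr f X Z x : vfield X -> vfield Z ->
  inner g Z (fscale f X) x = f x * inner g Z X x.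
Proof. by move=> [tX _] [tZ _]; exact: metricZr. Qed.

Lemma innerC X Y x : vfield X -> vfield Y -> inner g X Y x = inner g Y X x.
Proof. by move=> [tX _] [tY _]; exact: metric_sym. Qed.

Lemma oppr_fscale X : - X = fscale (fun=> -1) X.
Proof.
by apply/funext => x; apply/funext => f; rewrite /fscale mulN1r.
Qed.

Lemma innerNl X Z x : vfield X -> vfield Z -> inner g (- X) Z x = - inner g X Z x.
Proof. by move=> vX vZ; rewrite oppr_fscale innerZl// mulN1r. Qed.

Lemma innerNr X Z x : vfield X -> vfield Z -> inner g Z (- X) x = - inner g Z X x.
Proof. by move=> vX vZ; rewrite oppr_fscale innerZr// mulN1r. Qed.

(** Torsion-freeness writes the bracket as a difference of covariant derivatives, which avoids
    second derivatives in charts. *)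
Lemma vfield_bracket X Y : vfield X -> vfield Y -> vfield (bracket X Y).
Proof.
move=> vX vY; rewrite -(nabla_torsion_free nablaLC vX vY).
by apply: vfieldB; exact: nabla_vfield nablaLC _ _ _ _.
Qed.

Lemma vfield_riemann X Y Z : vfield X -> vfield Y -> vfield Z ->
  vfield (riemann nabla X Y Z).
Proof.
move=> vX vY vZ; have vn := nabla_vfield nablaLC.
by apply: vfieldB; [apply: vfieldB|]; apply: (vn) => //;
  [exact: vn|exact: vn|exact: vfield_bracket].
Qed.

Lemma apply_apply_inner X Y Z W x : vfield X -> vfield Y -> vfield Z -> vfield W ->
  apply X (apply Y (inner g Z W)) x =
  inner g (nabla X (nabla Y Z)) W x + inner g (nabla Y Z) (nabla X W) x +
  (inner g (nabla X Z) (nabla Y W) x + inner g Z (nabla X (nabla Y W)) x).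
Proof.
move=> vX vY vZ vW; have vn := nabla_vfield nablaLC.
have sg := metric_smooth gL.
have -> : apply Y (inner g Z W) =
    fun z => inner g (nabla Y Z) W z + inner g Z (nabla Y W) z.
  by apply/funext => z; rewrite (nabla_metric nablaLC).
rewrite /apply (tangent_addf (vX.1 x)); [|by apply: (sg) => //; exact: vn..].
by rewrite -!/(apply X _ x) !(nabla_metric nablaLC)//; exact: vn.
Qed.

(** The derivative of g(Z,W) along [X,Y] is computed by metric compatibility and as a commutator of
    second derivatives; in the latter the mixed terms such as g(nabla_Y Z, nabla_X W) cancel. *)
Lemma riemann_skew X Y Z W x : vfield X -> vfield Y -> vfield Z -> vfield W ->
  inner g (riemann nabla X Y Z) W x + inner g Z (riemann nabla X Y W) x = 0.
Proof.
move=> vX vY vZ vW; have vn := nabla_vfield nablaLC.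
have vB := vfield_bracket vX vY.
have := nabla_metric nablaLC vB vZ vW x.
have -> : apply (bracket X Y) (inner g Z W) x =
  apply X (apply Y (inner g Z W)) x - apply Y (apply X (inner g Z W)) x by [].
rewrite !apply_apply_inner//.
have [vXY vYX] : vfield (nabla X (nabla Y Z)) /\ vfield (nabla Y (nabla X Z)).
  by split; do 2 apply: (vn) => //.
have [vXYW vYXW] : vfield (nabla X (nabla Y W)) /\ vfield (nabla Y (nabla X W)).
  by split; do 2 apply: (vn) => //.
have vBZ : vfield (nabla (bracket X Y) Z) by exact: vn.
have vBW : vfield (nabla (bracket X Y) W) by exact: vn.
rewrite /riemann !(innerDl, innerDr, innerNl, innerNr)//;
  do ?[exact: vfieldN|exact: vfieldB].
lra.
Qed.

Lemma torse_forming_riemann xi X Y : vfield xi ->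
  (forall X, vfield X -> nabla X xi = X + fscale (inner g X xi) xi) ->
  vfield X -> vfield Y ->
  riemann nabla X Y xi = fscale (inner g Y xi) X - fscale (inner g X xi) Y.
Proof.
move=> vxi tf vX vY; have vn := nabla_vfield nablaLC.
have sg := metric_smooth gL.
(* Second covariant derivative of xi. After antisymmetrization the terms symmetric in A and B
   cancel, those in nabla_A B are absorbed by the bracket term, and eta(B) A remains. *)
have nn A B x f : vfield A -> vfield B ->
    nabla A (nabla B xi) x f = nabla A B x f +
      inner g B xi x * (A x f + inner g A xi x * xi x f) +
      (inner g (nabla A B) xi x +
        (inner g B A x + inner g A xi x * inner g B xi x)) * xi x f.
  move=> vA vB; have sBxi := sg _ _ vB vxi; have sAxi := sg _ _ vA vxi.
  rewrite (tf B vB) (nabla_addr nablaLC)//; last exact: vfieldZ.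
  rewrite (nabla_leibniz nablaLC)// (tf A vA).
  rewrite -[LHS]/(nabla A B x f + (inner g B xi x *
    (A x f + inner g A xi x * xi x f) + apply A (inner g B xi) x * xi x f)).
  rewrite (nabla_metric nablaLC)// (tf A vA) innerDr//; last exact: vfieldZ.
  by rewrite innerZr// addrA.
have vb := vfield_bracket vX vY.
apply/funext => x; apply/funext => f.
rewrite /riemann (tf _ vb).
rewrite -[LHS]/(nabla X (nabla Y xi) x f - nabla Y (nabla X xi) x f -
  (bracket X Y x f + inner g (bracket X Y) xi x * xi x f)).
rewrite -[RHS]/(inner g Y xi x * X x f - inner g X xi x * Y x f).
rewrite !nn// -(nabla_torsion_free nablaLC vX vY).
have [vXY vYX] := (vn _ _ vX vY, vn _ _ vY vX).
rewrite innerDl//; last exact: vfieldN.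
rewrite innerNl// (innerC _ vY vX).
rewrite -[(nabla X Y - nabla Y X) x f]/(nabla X Y x f - nabla Y X x f).
ring.
Qed.

Lemma torse_forming_ricci xi Y x : vfield xi ->
  (forall X, vfield X -> nabla X xi = X + fscale (inner g X xi) xi) ->
  vfield Y ->
  ricci nabla Y xi x = (n%:R - 1) * inner g Y xi x.
Proof.
move=> vxi tf vY; have tY := vY.1 x; have txi := vxi.1 x.
rewrite /ricci (@trace_rank_one _ _ _ _ gL _ x (inner g Y xi x)
  (fun u => g x u (xi x)) (fun f => -1 * Y x f)).
- by rewrite metricZl// mulrBl mulN1r mul1r.
- exact: tangentZ.
- by move=> t u v tu tv; exact: metric_linear.
- move=> X vX; rewrite torse_forming_riemann//.
  apply/funext => f.
  rewrite -[LHS]/(inner g Y xi x * X x f - inner g X xi x * Y x f).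
  by rewrite mulN1r mulrN.
Qed.

End connection.

(** * Perfect fluids with torse-forming velocity *)

Lemma connected_two_values (T : topologicalType) (R : realType) (b : T -> R)
    (u v : R) : connected [set: T] -> continuous b ->
  (forall x, b x = u \/ b x = v) -> (forall x, b x = u) \/ (forall x, b x = v).
Proof.
move=> Tconn cb buv; have [uv|uv] := eqVneq u v.
  by left=> x; have [|->] := buv x.
have [[x0 bx0]|nu] := pselect (exists x, b x = u); last first.
  by right=> x; have [bu|//] := buv x; case: nu; exists x.
left; suff BT : b @^-1` [set u] = [set: T].
  by move=> x; have : [set: T] x by []; rewrite -BT.
apply: Tconn; first by exists x0.
- exists (b @^-1` (~` [set v])).
    by apply: open_comp => [x _|]; [exact: cb|exact/closed_openC/closed_eq].
  rewrite setTI; apply/seteqP; split=> x /= bx.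
    by rewrite bx; exact/eqP.
  by have [|] := buv x.
- exists (b @^-1` [set u]); last by rewrite setTI.
  by apply: closed_comp => [x _|]; [exact: cb|exact: closed_eq].
Qed.

Section perfect_fluid.
Context {R : realType} {M : manifold R 4}.
Context (g : metric M) (gL : lorentzian g).
Context (nabla : tfield M -> tfield M -> tfield M).
Context (nablaLC : levi_civita g nabla).
Context (xi : tfield M) (xi_vf : vfield xi).
Context (xi_unit : forall x, inner g xi xi x = -1).
Context (torse_forming : forall X, vfield X ->
  nabla X xi = X + fscale (inner g X xi) xi).
Context (a b : M -> R).
Context (ricciE : forall X Y, vfield X -> vfield Y -> forall x,
  ricci nabla X Y x =
    a x * inner g X Y x + b x * (inner g X xi x * inner g Y xi x)).

(** The two expressions of S(xi,xi) are b - a, from the fluid form, and -3, from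
    [torse_forming_ricci]. *)
Lemma ricci_coef_relation x : a x = 3 + b x.
Proof.
have := torse_forming_ricci gL nablaLC x xi_vf torse_forming xi_vf.
rewrite ricciE// xi_unit => h; lra.
Qed.

Section ricci_operator.
Context (Q : tfield M -> tfield M) (QR : ricci_operator g nabla Q).

Lemma ricci_operatorE X x : vfield X ->
  Q X x = fun f => a x * X x f + b x * inner g X xi x * xi x f.
Proof.
move=> vX; have [vQ Qr] := QR vX; have [tX txi] := (vX.1 x, xi_vf.1 x).
have t1 : tangent x (fun f => a x * X x f) by exact: tangentZ.
have t2 : tangent x (fun f => b x * inner g X xi x * xi x f) by exact: tangentZ.
apply: (metric_nondegenerate gL (vQ.1 x)); first exact: tangentD.
(* The Ricci identities are stated for vector fields, so the test vector w is first extended to a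
   field W. *)
move=> w tw; have [W vW Ww] := vfield_extend tw; rewrite -Ww in tw *.
rewrite -[LHS]/(inner g (Q X) W x) Qr// ricciE//.
rewrite metricDl// !metricZl//.
by rewrite (innerC gL _ vW xi_vf) mulrA.
Qed.

Lemma scalar_curvatureE x : scalar_curvature Q x = 4 * a x - b x.
Proof.
have txi := xi_vf.1 x.
rewrite /scalar_curvature (@trace_rank_one _ _ _ _ gL _ x (a x)
  (fun u => g x u (xi x)) (fun f => b x * xi x f)).
- by rewrite metricZl// -/(inner g xi xi x) xi_unit mulrN1.
- exact: tangentZ.
- by move=> t u v tu tv; exact: metric_linear.
- move=> X vX; rewrite ricci_operatorE//; apply/funext => f.
  by rewrite /inner; ring.
Qed.

End ricci_operator.

(* Evaluating the condition on (X, X, xi), with X a spacelike unit vector at x,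
   gives (1 - c) b (1 + eta(X)^2) = 0. *)
Lemma annihilates_ricci_coef (T : tfield M -> tfield M -> tfield M -> tfield M)
    (c : M -> R) :
  (forall X Y, vfield X -> vfield Y -> vfield (T xi X Y)) ->
  (forall X Y x f, vfield X -> vfield Y ->
    T xi X Y x f = riemann nabla xi X Y x f +
      c x * (inner g Y xi x * X x f - inner g X Y x * xi x f)) ->
  annihilates_ricci nabla xi T -> forall x, (1 - c x) * b x = 0.
Proof.
move=> vT TE TS x; have [E [vE _ gE]] := orthonormal_frame gL x.
(* Index 0 is the timelike direction of the frame; index 1 is spacelike. *)
pose X := E (inord 1); have vX : vfield X by exact: vE.
have XX : inner g X X x = 1 by rewrite /inner gE eqxx /= inordK.
pose e := inner g X xi x.
have Xe : inner g xi X x = e by rewrite (innerC gL).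
have vR Z : vfield Z -> vfield (riemann nabla xi X Z).
  by move=> vZ; exact: (vfield_riemann nablaLC).
have [tX txi] := (vX.1 x, xi_vf.1 x).
have Rxi : riemann nabla xi X xi = fscale (inner g X xi) xi - fscale (inner g xi xi) X.
  exact: (torse_forming_riemann gL nablaLC).
have TxiE : T xi X xi x = fun f => (1 - c x) * (e * xi x f + X x f).
  apply/funext => f; rewrite TE// Rxi.
  rewrite -[(_ - _) x f]/(inner g X xi x * xi x f - inner g xi xi x * X x f).
  rewrite xi_unit -/e; ring.
have tw : tangent x (fun f => e * xi x f + X x f) by exact: tangent_lin.
have Txi u : tangent x u ->
    g x (T xi X xi x) u = (1 - c x) * (e * g x (xi x) u + g x (X x) u).
  by move=> tu; rewrite TxiE metricZl// (metric_linear gL).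
(* The torse-forming formula gives R(xi,X)xi only; skew-symmetry transfers it to g(R(xi,X)X, xi) =
   -(e^2 + 1). *)
have skew := riemann_skew gL nablaLC x xi_vf vX vX xi_vf.
have RX : inner g X (riemann nabla xi X xi) x = e ^+ 2 + 1.
  have [sX sxi] := (metric_smooth gL vX xi_vf, metric_smooth gL xi_vf xi_vf).
  have [v1 v2] := (vfieldZ sX xi_vf, vfieldZ sxi vX).
  rewrite Rxi innerDr//; last exact: vfieldN.
  by rewrite innerNr// !innerZr// xi_unit XX; rewrite -/e; ring.
have TXxi : inner g (T xi X X) xi x = (c x - 1) * (e ^+ 2 + 1).
  have -> : inner g (T xi X X) xi x = g x (fun f => 1 * riemann nabla xi X X x f +
      (c x * e * X x f + - c x * xi x f)) (xi x).
    rewrite /inner; congr (g x _ _); apply/funext => f.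
    by rewrite TE// XX -/e; ring.
  have tRX := (vR _ vX).1 x.
  have t1 : tangent x (fun f => - c x * xi x f) by exact: tangentZ.
  have t2 : tangent x (fun f => c x * e * X x f + - c x * xi x f) by exact: tangent_lin.
  rewrite !(metric_linear gL)// metricZl//.
  move: skew RX xi_unit; rewrite /e /inner => skew RX xu.
  rewrite xu; nra.
have := TS X X xi vX vX xi_vf x.
rewrite !ricciE//; try exact: vT.
rewrite TXxi xi_unit (innerC gL _ vX (vT _ _ vX xi_vf)).
have -> : inner g (T xi X xi) X x = (1 - c x) * (e ^+ 2 + 1).
  by rewrite /inner Txi// -/(inner g xi X x) -/(inner g X X x) XX Xe.
have -> : inner g (T xi X xi) xi x = 0.
  rewrite /inner Txi// -/(inner g xi xi x) -/(inner g X xi x) xi_unit -/e.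
  by rewrite mulrN1 addNr mulr0.
(* The two terms in a have opposite signs and cancel, which leaves a multiple of b. *)
rewrite ricci_coef_relation mulr0 => h.
have : (1 - c x) * b x * (1 + e ^+ 2) = 0 by rewrite -h; ring.
move/eqP; rewrite mulf_eq0 => /orP[/eqP//|].
by rewrite gt_eqF// ltr_wpDr// sqr_ge0.
Qed.

End perfect_fluid.

Theorem theorem3p1 (R : realType) (M : manifold R 4)
    (g : metric M) (nabla : tfield M -> tfield M -> tfield M)
    (Q : tfield M -> tfield M) (xi : tfield M) (p sigma : M -> R)
    (lambda k : R)
    (Mconn : connected [set: M])
    (gL : lorentzian g)
    (nablaLC : levi_civita g nabla)
    (QR : ricci_operator g nabla Q)
    (xi_vf : vfield xi)
    (xi_unit : forall x, inner g xi xi x = -1)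
    (p_smooth : smooth p) (sigma_smooth : smooth sigma)
    (k_gt0 : 0 < k)
    (fluid : forall X Y, vfield X -> vfield Y -> forall x,
       ricci nabla X Y x =
         - (lambda - scalar_curvature Q x / 2 - k * p x) * inner g X Y x
         + k * (sigma x + p x) * (inner g X xi x * inner g Y xi x))
    (torse_forming : forall X, vfield X ->
       nabla X xi = X + fscale (inner g X xi) xi) :
  [/\ annihilates_ricci nabla xi (riemann nabla) ->
        forall x, p x = - sigma x,
      annihilates_ricci nabla xi (concircular g nabla Q) ->
        (forall x, p x = - sigma x) \/
        (forall x, p x = (4 * lambda + k * sigma x - 12) / (3 * k)),
      annihilates_ricci nabla xi (conformal g nabla Q) ->
        (forall x, p x = - sigma x) \/
        (forall x, p x = (2 * lambda - k * sigma x - 6) / (3 * k)) &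
      annihilates_ricci nabla xi (conharmonic g nabla Q) ->
        (forall x, p x = - sigma x) \/
        (forall x, p x = (lambda - 1) / k)].
Proof.
set r := scalar_curvature Q.
pose a x := - (lambda - r x / 2 - k * p x).
pose b x := k * (sigma x + p x).
have aE x : a x = 3 + b x.
  exact: (ricci_coef_relation gL nablaLC xi_vf xi_unit torse_forming fluid).
have rE x : r x = 12 + 3 * b x.
  rewrite /r (scalar_curvatureE gL xi_vf xi_unit fluid QR) -/(a x) -/(b x) aE.
  ring.
(* Substituting r = 12 + 3 b into the definition of a and equating with 3 + b. *)
have bE x : b x = 2 * lambda - 6 - 2 * (k * p x).
  have := aE x; rewrite /a rE => ?; lra.
have k0 : k != 0 by rewrite gt_eqF.
have b0P x : b x = 0 -> p x = - sigma x.
  by move/eqP; rewrite mulf_eq0 (negbTE k0) /= addr_eq0 => /eqP ->; rewrite opprK.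
have b_smooth : smooth b.
  by apply: smooth_mul; [exact: smooth_cst|exact: smooth_add].
have coef := annihilates_ricci_coef gL nablaLC xi_vf xi_unit torse_forming fluid.
have vR X Y : vfield X -> vfield Y -> vfield (riemann nabla xi X Y).
  exact: (vfield_riemann nablaLC).
have sg := metric_smooth gL.
split.
- move=> /(coef _ (fun=> 0)) b0 x; apply: b0P.
  rewrite -[LHS]mul1r -[X in X * _]subr0; apply: b0 => // X Y z f _ _.
  by rewrite mul0r addr0.
(* Here c = r / 12 = 1 + b / 4, so (1 - c) b = 0 is - b^2 / 4 = 0 and the first alternative
   holds. *)
- move=> /(coef _ (fun x => r x / 12)) rb; left=> x; apply: b0P.
  have : (1 - r x / 12) * b x = 0.
    apply: rb => [X Y vX vY|X Y z f vX vY].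
      apply: vfieldD; first exact: vR.
      apply: vfieldZ.
        have -> : (fun x => scalar_curvature Q x / 12) = fun x => 1 + 4^-1 * b x.
          by apply/funext => z; rewrite -/(r z) rE; field.
        by apply: smooth_add; [|apply: smooth_mul => //]; exact: smooth_cst.
      by apply: vfieldB; apply: vfieldZ => //; exact: sg.
    by [].
  have -> : (1 - r x / 12) * b x = - 4^-1 * (b x * b x) by rewrite rE; field.
  move=> h; have /eqP : b x * b x = 0 by lra.
  by rewrite mulf_eq0 orbb => /eqP.
(* [bE] reads k (sigma + p) = 2 lambda - 6 - 2 k p, which is solved for p. *)
- move=> _; right=> x; have := bE x; rewrite /b => h.
  apply: (mulIf (_ : 3 * k != 0)); first by rewrite mulf_neq0.
  by rewrite divfK ?mulf_neq0//; lra.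
(* Since Q xi = (a - b) xi = 3 xi and S(Y,xi) = 3 eta(Y), the terms in b eta(X) eta(Y) xi cancel and
   the coefficient c = (3 + a) / 2 is left. *)
- move=> /(coef _ (fun x => (3 + a x) / 2)) ab.
  have {}ab x : b x = 0 \/ b x = - 4.
    have : (1 - (3 + a x) / 2) * b x = 0.
      apply: ab => [X Y vX vY|X Y z f vX vY].
        have sS A B : vfield A -> vfield B -> smooth (ricci nabla A B).
          move=> vA vB.
          have -> : ricci nabla A B = fun x => (3 + b x) * inner g A B x +
              b x * (inner g A xi x * inner g B xi x).
            by apply/funext => z; rewrite -aE fluid.
          apply: smooth_add; apply: smooth_mul => //.
          - by apply: smooth_add => //; exact: smooth_cst.
          - exact: sg.
          - by apply: smooth_mul; exact: sg.
        have vQ A vA := (QR A vA).1.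
        apply: vfieldD; first exact: vR.
        apply: vfieldZ; first exact: smooth_cst.
        apply: vfieldB; [apply: vfieldD; [apply: vfieldB|]|];
          apply: vfieldZ => //; try exact: sg; try exact: sS; exact: vQ.
      have -> : conharmonic g nabla Q xi X Y z f = riemann nabla xi X Y z f +
        1 / 2 * (inner g Y xi z * Q X z f - inner g X Y z * Q xi z f +
                 ricci nabla Y xi z * X z f - ricci nabla X Y z * xi z f) by [].
      have QE A := ricci_operatorE gL xi_vf fluid QR (X := A) z.
      by rewrite !QE// !fluid// xi_unit -/r -/(a z) -/(b z) aE; field.
    rewrite aE => /eqP; rewrite mulf_eq0 => /orP[|] /eqP h; [right|left]; lra.
  (* At each point b is 0 or -4; continuity on the connected M selects one value globally, and b =
     -4 in [bE] gives k p = lambda - 1. *)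
  have [b0|b4] := connected_two_values Mconn (smooth_continuous b_smooth) ab.
    by left=> x; exact: b0P.
  right=> x; apply: (mulIf k0); rewrite divfK//.
  by have := bE x; rewrite b4 => ?; lra.
Qed.
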